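(* Let $F$ be a field and let $N$ be a non-negative integer. A set $V$ equipped with addition and scalar multiplication (over $F$) is an $N$-dimensional vector space (in the sense that $V \cong F^N$) if and only if it is the standard notion of an $N$-dimensional vector space.
   Context: Fix an arbitrary field $F$; its elements are called scalars. A set $X$ is equipped with addition and scalar multiplication if it comes with a map $X \times X \to X$, $(x,y) \mapsto x+y$, and a map $F \times X \to X$, $(a,x) \mapsto ax$ (also written $a \cdot x$). No axioms whatsoever are imposed on these two maps. For sets $X, Y$ equipped with addition and scalar multiplication, a map $f \colon X \to Y$ is linear if $f(x+y) = f(x)+f(y)$ for all $x,y \in X$ and $f(ax) = a \cdot f(x)$ for all $a \in F$, $x \in X$. An isomorphism is a linear map that is invertible as a map (there is a map $g \colon Y \to X$ with $g \circ f$ and $f \circ g$ identity maps). Write $X \cong Y$ if there is an isomorphism from $X$ to $Y$. $F^N$ is the set of column vectors $[s_1,\dots,s_N]^{\mathsf T}$ with $s_1,\dots,s_N \in F$ if $N>0$, and the one-element set consisting of the zero vector if $N=0$, with componentwise addition and scalar multiplication. $N$-dimensional vector space: a set $V$ equipped with addition and scalar multiplication is called an $N$-dimensional vector space if $V \cong F^N$. Standard notion of a vector space: a set $V$ equipped with addition and scalar multiplication that contains an element $\mathbf{0}$ such that for all $a,b \in F$ and $x,y,z \in V$: (1) $x + \mathbf{0} = x$; (2) $x+(y+z) = (x+y)+z$; (3) $x+y = y+x$; (4) $1x = x$; (5) $a(bx) = (ab)x$; (6) $a(x+y) = ax+ay$; (7) $(a+b)x = ax+bx$; (8) $0x = \mathbf{0}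 = a\mathbf{0}$. Standard notion of an $N$-dimensional vector space: a standard notion of a vector space $V$ for which there exists a set $Y \subseteq V$ of $N$ elements (a basis of $V$) such that each $x \in V$ can be uniquely expressed in the form $x = \sum_{y \in Y} x_y \cdot y$ with $x_y \in F$. *)

(* Defs.v *)
From mathcomp Require Import all_boot all_order all_algebra.

Set Implicit Arguments.
Unset Strict Implicit.
Unset Printing Implicit Defensive.

Import GRing.Theory.
Local Open Scope ring_scope.

Record opset (F : fieldType) := OpSet {
  carrier :> Type;
  oadd : carrier -> carrier -> carrier;
  oscale : F -> carrier -> carrier
}.

Declare Scope opset_scope.
Delimit Scope opset_scope with opset.
Notation "x '+o' y" := (oadd x y)
  (at level 50, left associativity) : opset_scope.
Notation "a '*o' x" := (oscale a x)
  (at level 40, left associativity) : opset_scope.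
Local Open Scope opset_scope.

Definition is_linear (F : fieldType) (X Y : opset F) (f : X -> Y) : Prop :=
  (forall x y : X, f (x +o y) = f x +o f y) /\
  (forall (a : F) (x : X), f (a *o x) = a *o f x).

Definition isomorphic (F : fieldType) (X Y : opset F) : Prop :=
  exists f : X -> Y, is_linear f /\ bijective f.

Definition coord_space (F : fieldType) (N : nat) : opset F :=
  @OpSet F 'cV[F]_N (fun x y => x + y) (fun a x => a *: x).

Definition is_dim_vector_space (F : fieldType) (N : nat) (V : opset F) : Prop :=
  isomorphic V (coord_space F N).

Record std_vector_space_axioms (F : fieldType) (V : opset F) (zero : V) : Prop :=
  StdVectorSpaceAxioms {
    std_add0 : forall x : V, x +o zero = x;
    std_addA : forall x y z : V, x +o (y +o z) = (x +o y) +o z;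
    std_addC : forall x y : V, x +o y = y +o x;
    std_scale1 : forall x : V, 1 *o x = x;
    std_scaleA : forall (a b : F) (x : V), a *o (b *o x) = (a * b) *o x;
    std_scaleDr : forall (a : F) (x y : V), a *o (x +o y) = a *o x +o a *o y;
    std_scaleDl : forall (a b : F) (x : V), (a + b) *o x = a *o x +o b *o x;
    std_scale0 : forall (a : F) (x : V), 0 *o x = zero /\ zero = a *o zero
  }.

(* The sum of the c_y y over all y in Y. The bijection e enumerates the finite
   set Y; when the addition is commutative and associative with neutral element
   zero, the value does not depend on e. It is zero if Y is empty. *)
Definition lin_comb (F : fieldType) (V : opset F) (zero : V) (Y : V -> Prop)
    (N : nat) (e : 'I_N -> {y : V | Y y}) (c : {y : V | Y y} -> F) : V :=
  \big[@oadd F V / zero]_(i < N) (c (e i) *o sval (e i)).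

Definition is_basis (F : fieldType) (V : opset F) (zero : V) (N : nat)
    (Y : V -> Prop) : Prop :=
  exists e : 'I_N -> {y : V | Y y}, bijective e /\
  forall x : V, exists c : {y : V | Y y} -> F,
    x = lin_comb zero e c /\
    forall c' : {y : V | Y y} -> F, x = lin_comb zero e c' -> c' =1 c.

Definition is_std_dim_vector_space (F : fieldType) (N : nat) (V : opset F) : Prop :=
  exists zero : V, std_vector_space_axioms zero /\
  exists Y : V -> Prop, is_basis zero N Y.

(* Main.v *)
Require Import Defs.
From mathcomp Require Import all_boot all_order all_algebra.
From Stdlib Require Import IndefiniteDescription.

(** An isomorphism with the space of column vectors transports both the
    vector space axioms and the standard basis to [V]: equations can be checked
    after applying the injective linear map ([std_axioms_of_iso]), and the
    preimages of the unit vectors form a basis because the coordinates of [x] on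
    them must be the entries of its image ([basis_of_iso]).

    Conversely, a basis enumerated by [e] defines the synthesis map sending a
    column [u] to the combination of the [e i] with coefficients [u i].  The
    axioms make it linear, existence of coordinates makes it surjective and
    uniqueness makes it injective ([synthesis_linear], [synthesis_surj],
    [synthesis_inj]).  Its inverse is then automatically linear
    ([isomorphic_sym]) and is the required isomorphism. As [V] is an arbitrary
    type, the coordinate map exists as a function only by a choice
    principle ([inj_surj_bijective]). *)

Set Implicit Arguments.
Unset Strict Implicit.
Unset Printing Implicit Defensive.

Import GRing.Theory.
Local Open Scope ring_scope.
Local Open Scope opset_scope.

(** Surjectivity only asserts preimages one at a time; choice collects them into
    an inverse function, which [bijective] asks for. *)
Lemma inj_surj_bijective (A B : Type) (h : A -> B) :
  injective h -> (forall y, exists x, h x = y) -> bijective h.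
Proof.
move=> h_inj h_surj.
have [k hk] := functional_choice (fun y x => h x = y) h_surj.
by exists k => // x; apply: h_inj; rewrite hk.
Qed.

(** The inverse of a linear bijection is linear, because the two equations for
    it hold after applying the injective map that it inverts. *)
Lemma isomorphic_sym (F : fieldType) (X Y : opset F) :
  isomorphic X Y -> isomorphic Y X.
Proof.
case=> f [[fD fZ] [g fK gK]]; exists g; split; last by exists f.
split=> [x y | a x]; apply: (can_inj fK).
  by rewrite fD !gK.
by rewrite fZ !gK.
Qed.

Section FromIso.

Variables (F : fieldType) (N : nat) (V : opset F).
Variables (f : V -> 'cV[F]_N) (g : 'cV[F]_N -> V).
Hypotheses (fK : cancel f g) (gK : cancel g f).
Hypothesis fD : forall x y : V, f (x +o y) = f x + f y.
Hypothesis fZ : forall (a : F) (x : V), f (a *o x) = a *: f x.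

Lemma std_axioms_of_iso : std_vector_space_axioms (g 0).
Proof.
have f_inj := can_inj fK.
split.
- by move=> x; apply: f_inj; rewrite fD gK addr0.
- by move=> x y z; apply: f_inj; rewrite !fD addrA.
- by move=> x y; apply: f_inj; rewrite !fD addrC.
- by move=> x; apply: f_inj; rewrite fZ scale1r.
- by move=> a b x; apply: f_inj; rewrite !fZ scalerA.
- by move=> a x y; apply: f_inj; rewrite !(fD, fZ) scalerDr.
- by move=> a b x; apply: f_inj; rewrite !(fD, fZ) scalerDl.
- by move=> a x; split; apply: f_inj; rewrite !(fZ, gK) ?scale0r ?scaler0.
Qed.

(** A boolean predicate, so that elements of the subtype it defines are equal
    as soon as their values are. *)
Definition unit_preim (y : V) : bool := [exists i, f y == delta_mx i 0].

Lemma unit_preimP (i : 'I_N) : unit_preim (g (delta_mx i 0)).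
Proof. by apply/existsP; exists i; rewrite gK. Qed.

Definition unit_enum (i : 'I_N) : {y : V | unit_preim y} :=
  exist _ (g (delta_mx i 0)) (unit_preimP i).

Definition unit_index (s : {y : V | unit_preim y}) : 'I_N :=
  xchoose (existsP (svalP s)).

Lemma f_unit_index (s : {y : V | unit_preim y}) :
  f (sval s) = delta_mx (unit_index s) 0.
Proof. exact/eqP/(xchooseP (existsP (svalP s))). Qed.

Lemma unit_indexK : cancel unit_index unit_enum.
Proof. by move=> s; apply: val_inj; rewrite /= -f_unit_index fK. Qed.

Lemma delta_col_inj : injective (fun i : 'I_N => delta_mx i 0 : 'cV[F]_N).
Proof.
move=> i j /matrixP/(_ i 0); rewrite !mxE !eqxx /= andbT.
by case: eqP => // _ /eqP; rewrite oner_eq0.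
Qed.

Lemma unit_enumK : cancel unit_enum unit_index.
Proof.
by move=> i; apply: delta_col_inj; rewrite -f_unit_index /= gK.
Qed.

(** Since coefficients can be read off the image, this gives both existence and
    uniqueness of coordinates. *)
Lemma f_lin_comb (c : {y : V | unit_preim y} -> F) :
  f (lin_comb (g 0) unit_enum c) = \col_i c (unit_enum i).
Proof.
rewrite /lin_comb (big_morph f fD (gK 0)) [RHS]matrix_sum_delta.
by apply: eq_bigr => i _; rewrite big_ord1 !mxE fZ gK.
Qed.

Lemma basis_of_iso : is_basis (g 0) N unit_preim.
Proof.
exists unit_enum; split.
  by exists unit_index; [exact: unit_enumK | exact: unit_indexK].
move=> x; exists (fun s => f x (unit_index s) 0); split.
  apply: (can_inj fK); rewrite f_lin_comb.
  by apply/colP=> i; rewrite mxE unit_enumK.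
by move=> c' -> s; rewrite f_lin_comb mxE unit_indexK.
Qed.

End FromIso.

Section FromBasis.

Variables (F : fieldType) (N : nat) (V : opset F) (zero : V).
Hypothesis axV : std_vector_space_axioms zero.
Variables (Y : V -> Prop) (e : 'I_N -> {y : V | Y y}) (k : {y : V | Y y} -> 'I_N).
Hypotheses (eK : cancel e k) (kK : cancel k e).
Hypothesis e_coord : forall x : V, exists c : {y : V | Y y} -> F,
  x = lin_comb zero e c /\
  forall c' : {y : V | Y y} -> F, x = lin_comb zero e c' -> c' =1 c.

Lemma eq_lin_comb (c c' : {y : V | Y y} -> F) :
  c =1 c' -> lin_comb zero e c = lin_comb zero e c'.
Proof. by move=> eqc; apply: eq_bigr => i _; rewrite eqc. Qed.

Lemma lin_combD (c c' : {y : V | Y y} -> F) :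
  lin_comb zero e (fun s => c s + c' s) =
  lin_comb zero e c +o lin_comb zero e c'.
Proof.
have [add0 addA addC _ _ _ scaleDl _] := axV.
rewrite /lin_comb; elim/big_rec3: _ => [|i x y z _ ->]; first by rewrite add0.
rewrite scaleDl -!addA; congr (_ +o _).
by rewrite !addA; congr (_ +o _); exact: addC.
Qed.

Lemma lin_combZ (a : F) (c : {y : V | Y y} -> F) :
  lin_comb zero e (fun s => a * c s) = a *o lin_comb zero e c.
Proof.
have [_ _ _ _ scaleA scaleDr _ scale0] := axV.
rewrite /lin_comb (big_morph (oscale a) (scaleDr a) (esym (scale0 a zero).2)).
by apply: eq_bigr => i _; rewrite scaleA.
Qed.

Definition synthesis (u : coord_space F N) : V :=
  lin_comb zero e (fun s => (u : 'cV[F]_N) (k s) 0).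

Lemma synthesis_linear : is_linear synthesis.
Proof.
split=> [u v | a u].
  by rewrite /synthesis -lin_combD; apply: eq_lin_comb => s; rewrite mxE.
by rewrite /synthesis -lin_combZ; apply: eq_lin_comb => s; rewrite mxE.
Qed.

(** Two columns with the same image give two coordinate families of one vector,
    and both agree with the unique one. *)
Lemma synthesis_inj : injective synthesis.
Proof.
move=> u v eq_uv; have [c [_ c_uniq]] := e_coord (synthesis u).
apply/colP=> i; rewrite -(eK i).
by rewrite (c_uniq _ (erefl _) (e i)) -(c_uniq _ eq_uv (e i)).
Qed.

Lemma synthesis_surj (x : V) : exists u, synthesis u = x.
Proof.
have [c [-> _]] := e_coord x; exists (\col_i c (e i)).
by apply: eq_lin_comb => s; rewrite mxE kK.
Qed.

Lemma coord_space_iso_of_basis : isomorphic (coord_space F N) V.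
Proof.
exists synthesis; split; first exact: synthesis_linear.
exact: inj_surj_bijective synthesis_inj synthesis_surj.
Qed.

End FromBasis.

Theorem proposition1 (F : fieldType) (N : nat) (V : opset F) :
  is_dim_vector_space N V <-> is_std_dim_vector_space N V.
Proof.
split.
  case=> f [[fD fZ] [g fK gK]]; exists (g 0); split.
    exact: std_axioms_of_iso fK gK fD fZ.
  by exists (unit_preim f); exact: basis_of_iso fK gK fD fZ.
case=> zero [axV [Y [e [[k eK kK] e_coord]]]].
exact/isomorphic_sym/(coord_space_iso_of_basis axV eK kK e_coord).
Qed.
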